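(* Let $K$ be a field, let $G$ be a graph on $[n]$, $S=K[x_1,\dots,x_n,y_1,\dots,y_n]$, and suppose the binomial edge ideal $J_G\subset S$ is of König type. Then $S/J_G$ has a special system of parameters of attached form; that is, there exist a sequence $\mathbf f=f_1,\dots,f_h$ ($h=\operatorname{height}J_G$) and a monomial order $<$ on $S$ such that $J_G$ is of König type with respect to $\mathbf f$ and $<$ and the sequence $C$ of linear forms attached to $\mathbf f$ and $<$ is a system of parameters of $S/J_G$.
   Context: Graphs are finite and simple. The binomial edge ideal of $G$ is $J_G=(x_iy_j-x_jy_i : i<j,\ \{i,j\}\in E(G))$. A graded ideal $I$ of height $h$ in a polynomial ring over $K$ is of König type with respect to a sequence $\mathbf f=f_1,\dots,f_h$ of homogeneous polynomials and a monomial order $<$ if $f_1,\dots,f_h$ forms part of a minimal system of generators of $I$ and $\operatorname{in}_<(f_1),\dots,\operatorname{in}_<(f_h)$ is a regular sequence; $I$ is of König type if this holds for some $\mathbf f$ and some $<$. Attached sequence: let $z_1,\dots,z_N$ be the variables of the polynomial ring (for $S$, $N=2n$ and the $z_i$ are $x_1,\dots,x_n,y_1,\dots,y_n$ in this order), and let $u_j=\operatorname{in}_<(f_j)$. Let $A$ be the set of variables dividing none of the $u_j$, let $B_j$ be the set of variables dividing $u_j$ (these sets are pairwise disjoint), let $i_j$ be the smallest index with $z_{i_j}\in B_j$, and put $C_j=\{z_k-z_{i_j} : z_k\in B_j,\ k\neq i_j\}$. The sequence attached to $\mathbf f$ and $<$ is $C=A\cup C_1\cup\dots\cup C_h$; it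 has $N-h=\dim S/I$ elements. A system of parameters is called special if each of its elements is (the residue class of) a variable or a difference of two variables. *)

(* Defs.v *)
From HB Require Import structures.
From mathcomp Require Import all_boot all_order all_algebra.
From mathcomp Require Import mpoly.

Set Implicit Arguments.
Unset Strict Implicit.
Unset Printing Implicit Defensive.

Import GRing.Theory.
Local Open Scope ring_scope.

Section Ideals.

Variables (K : fieldType) (N : nat).
Local Notation S := {mpoly K[N]}.

(* Ideals are Prop-valued: the [idealr_closed] of ring_quotient is about
   boolean predicates, i.e. ideals with decidable membership. *)
Definition is_ideal (I : S -> Prop) : Prop :=
  I 0 /\ forall a f g, I f -> I g -> I (a * f + g).

Definition prime_ideal (P : S -> Prop) : Prop :=
  [/\ is_ideal P, ~ P 1 & forall f g, P (f * g) -> P f \/ P g].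

Definition ideal_gen (s : seq S) (g : S) : Prop :=
  exists c : 'I_(size s) -> S, g = \sum_(i < size s) c i * s`_i.

Definition ideal_add (I J : S -> Prop) (g : S) : Prop :=
  exists a b, [/\ I a, J b & g = a + b].

Definition ideal_sub (I J : S -> Prop) : Prop := forall g, I g -> J g.

Definition ideal_ssub (I J : S -> Prop) : Prop :=
  ideal_sub I J /\ ~ ideal_sub J I.

(* P 0 < P 1 < ... < P k, a chain of length k; the values P i for i > k are
   irrelevant. *)
Definition prime_chain (k : nat) (P : nat -> S -> Prop) : Prop :=
  (forall i, (i <= k)%N -> prime_ideal (P i)) /\
  (forall i, (i < k)%N -> ideal_ssub (P i) (P i.+1)).

(* ht Q >= k, for a prime ideal Q *)
Definition prime_height_ge (Q : S -> Prop) (k : nat) : Prop :=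
  exists2 P, prime_chain k P & forall g, P k g <-> Q g.

(* h is the minimum of ht Q over the prime ideals Q containing I. *)
Definition height (I : S -> Prop) (h : nat) : Prop :=
  (forall Q, prime_ideal Q -> ideal_sub I Q -> prime_height_ge Q h) /\
  (exists Q, [/\ prime_ideal Q, ideal_sub I Q
               & forall k, prime_height_ge Q k -> (k <= h)%N]).

(* The Krull dimension of S/I, whose prime ideals are the Q/I for Q a prime
   ideal of S containing I. *)
Definition krull_dim_quot (I : S -> Prop) (d : nat) : Prop :=
  (exists2 P, prime_chain d P & ideal_sub I (P 0%N)) /\
  (forall k P, prime_chain k P -> ideal_sub I (P 0%N) -> (k <= d)%N).

Definition homogeneous (f : S) : Prop := exists d, f \is d.-homog.

(* Homogeneous system of parameters of the graded ring S/I. *)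
Definition system_of_parameters (I : S -> Prop) (s : seq S) : Prop :=
  [/\ forall t, t \in s -> exists2 d, (0 < d)%N & t \is d.-homog,
      krull_dim_quot I (size s)
    & krull_dim_quot (ideal_add I (ideal_gen s)) 0].

Definition special_system_of_parameters (I : S -> Prop) (s : seq S) : Prop :=
  system_of_parameters I s /\
  forall t, t \in s ->
    (exists k, t = 'X_k) \/ (exists k l, k != l /\ t = 'X_k - 'X_l).

Definition regular_sequence (s : seq S) : Prop :=
  (forall i, (i < size s)%N ->
     forall g, ideal_gen (take i s) (g * s`_i) -> ideal_gen (take i s) g) /\
  ~ ideal_gen s 1.

Definition generates (I : S -> Prop) (s : seq S) : Prop :=
  forall g, I g <-> ideal_gen s g.

(* For homogeneous generators of a graded ideal, minimality under inclusion
   and minimality of the number of generators agree. *)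
Definition minimal_generators (I : S -> Prop) (s : seq S) : Prop :=
  [/\ forall f, f \in s -> homogeneous f,
      generates I s
    & forall i, (i < size s)%N -> ~ generates I (take i s ++ drop i.+1 s)].

Definition monomial_order (le : rel 'X_{1..N}) : Prop :=
  [/\ reflexive le, antisymmetric le, transitive le & total le] /\
  (forall m, le 0%MM m) /\
  (forall m1 m2 m, le m1 m2 -> le (m1 + m)%MM (m2 + m)%MM).

(* Exponent of the initial monomial; equal to 0 (a dummy value) for f = 0. *)
Definition in_exp (le : rel 'X_{1..N}) (f : S) : 'X_{1..N} :=
  foldr (fun m1 m2 => if le m1 m2 then m2 else m1) 0%MM (msupp f).

Definition in_mon (le : rel 'X_{1..N}) (f : S) : S :=
  if f == 0 then 0 else 'X_[in_exp le f].

Definition konig_type_wrt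
    (I : S -> Prop) (f : seq S) (le : rel 'X_{1..N}) : Prop :=
  [/\ monomial_order le,
      height I (size f),
      exists g, minimal_generators I (f ++ g)
    & regular_sequence [seq in_mon le p | p <- f]].

Definition konig_type (I : S -> Prop) : Prop :=
  exists f le, konig_type_wrt I f le.

(* [enum 'I_N] is increasing, so the head of the filtered list is the smallest
   index of a variable dividing 'X_[m]. *)
Definition attached_block (m : 'X_{1..N}) : seq S :=
  if [seq k <- enum 'I_N | (0 < m k)%N] is i :: B
  then [seq 'X_k - 'X_i | k <- B] else [::].

Definition attached_sequence (f : seq S) (le : rel 'X_{1..N}) : seq S :=
  [seq 'X_k | k <- enum 'I_N & all (fun p => in_exp le p k == 0%N) f] ++
  flatten [seq attached_block (in_exp le p) | p <- f].

End Ideals.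

(* The variables of {mpoly K[n + n]} are x_1, ..., x_n, y_1, ..., y_n, in this
   order. *)
Definition xvar (K : fieldType) (n : nat) (i : 'I_n) : {mpoly K[n + n]} :=
  'X_(lshift n i).
Definition yvar (K : fieldType) (n : nat) (i : 'I_n) : {mpoly K[n + n]} :=
  'X_(rshift n i).

Arguments xvar K {n} i.
Arguments yvar K {n} i.

Definition binomial_edge_gens (K : fieldType) (n : nat) (E : rel 'I_n) :
    seq {mpoly K[n + n]} :=
  [seq xvar K p.1 * yvar K p.2 - xvar K p.2 * yvar K p.1
     | p <- enum [pred p : 'I_n * 'I_n | (p.1 < p.2)%N && E p.1 p.2]].

Arguments binomial_edge_gens K {n} E.

Definition binomial_edge_ideal (K : fieldType) (n : nat) (E : rel 'I_n) :
    {mpoly K[n + n]} -> Prop :=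
  ideal_gen (binomial_edge_gens K E).

Arguments binomial_edge_ideal K {n} E _.

(* Main.v *)
Require Import Defs.
From mathcomp Require Import all_boot all_order all_algebra.
From mathcomp Require Import mpoly.
From mathcomp Require Import ring zify.
From Stdlib Require Import Classical.

Set Implicit Arguments.
Unset Strict Implicit.
Unset Printing Implicit Defensive.

Import GRing.Theory.

(** Let [J] be the binomial edge ideal and [f], [<=] a sequence and a monomial
    order witnessing the König property; the sequence attached to this very [f]
    is a system of parameters.

    The initial monomials.  [J] is generated by quadrics, so the members of a
    minimal system of generators are quadrics ([minimal_generator_homog]), and a
    quadric in [J], having opposite coefficients at [x_a y_b] and [x_b y_a],
    contains both monomials or none ([edge_quadric]).  The initial monomials are
    therefore of the form [x_a y_b] with [{a,b}] an edge and [x_b y_a < x_a y_b]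
    ([koenig_arc]).  View them as arcs from [a] to [b].  Since they form a regular
    sequence they share no variable ([koenig_coprime]), and along an arc the
    formal quotient [x_a / y_a] decreases ([above_trans]): the arcs form
    vertex-disjoint directed paths.

    The quotient by the attached sequence.  That sequence contains [y_b - x_a]
    for every arc, and [y_b] or [x_a] where no arc arrives at [b] or leaves [a].
    In a prime containing [J] and the sequence, [x_a y_b - x_b y_a] becomes
    [x_a ^ 2 - x_b y_a]; going along the paths from their starting points one
    finds all variables in the prime ([variable_in_prime]), so the quotient has
    dimension 0.  The sequence has [2n - h] elements ([size_attached_sequence]).

    The dimension of [S/J].  A chain of primes above [J] extends a chain of
    length [h] below its first member, and no chain in [S] is longer than [2n]
    because [N + 1] polynomials in [N] variables are algebraically dependent
    ([no_long_prime_chain]); this bounds the dimension by [2n - h].  Conversely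
    let [Q] be a prime over [J] of height at most [h], let [T] be the set of
    vertices [i] with [x_i] and [y_i] in [Q], and let [P_T] be the prime
    generated by the [x_i], [y_i] for [i] in [T] and all the 2-minors inside the
    connected components of the graph outside [T].  Then [J] lies in [P_T] and
    [P_T] lies in [Q], and an explicit chain of length [2n] passes through [P_T]
    ([component_chainP]).  Its part below [P_T] has length at most [h] since it
    can be ended by [Q], so its part above [P_T] has length at least [2n - h].
    The members of that chain are the kernels of parametrizations; this makes
    them prime for free, and [subst_ker_sub_prime] gives [P_T <= Q]. *)

(** * Ideals *)

Section Ideals.

Local Open Scope ring_scope.

Variables (K : fieldType) (N : nat).
Local Notation S := {mpoly K[N]}.
Implicit Types (I J P Q : S -> Prop) (f g a : S) (s : seq S).

Lemma ideal_mull I a f : is_ideal I -> I f -> I (a * f).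
Proof. by case=> I0 IA If; rewrite -[a * f]addr0; apply: IA. Qed.

Lemma ideal_mulr I a f : is_ideal I -> I f -> I (f * a).
Proof. by rewrite mulrC; apply: ideal_mull. Qed.

Lemma ideal_addr I f g : is_ideal I -> I f -> I g -> I (f + g).
Proof. by case=> I0 IA If Ig; rewrite -[f]mul1r; apply: IA. Qed.

Lemma ideal_opp I f : is_ideal I -> I f -> I (- f).
Proof. by move=> hI If; rewrite -mulN1r; apply: ideal_mull. Qed.

Lemma ideal_subr I f g : is_ideal I -> I f -> I g -> I (f - g).
Proof. by move=> hI If Ig; apply: ideal_addr (ideal_opp _ _). Qed.

Lemma ideal_sum I (T : Type) (r : seq T) (B : pred T) (F : T -> S) :
  is_ideal I -> (forall i, B i -> I (F i)) -> I (\sum_(i <- r | B i) F i).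
Proof.
move=> hI hF; elim/big_rec: _ => [|i x Bi Ix]; first by case: hI.
exact: ideal_addr (hF _ Bi) Ix.
Qed.

Lemma ideal_eqmod I f g : is_ideal I -> I (f - g) -> I f <-> I g.
Proof.
move=> hI Ifg; split=> [If|Ig]; last first.
  by rewrite -[f](subrK g); apply: ideal_addr.
have -> : g = f - (f - g) by ring.
exact: ideal_subr.
Qed.

Lemma ideal_gen_is_ideal s : is_ideal (ideal_gen s).
Proof.
split; first by exists (fun=> 0); rewrite big1 // => i _; rewrite mul0r.
move=> a f g [c ->] [d ->]; exists (fun i => a * c i + d i).
by rewrite mulr_sumr -big_split; apply: eq_bigr => i _ /=; ring.
Qed.

Lemma mem_ideal_gen s f : f \in s -> ideal_gen s f.
Proof.
move=> fs; have lt_fs : (index f s < size s)%N by rewrite index_mem.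
exists (fun i => (i == Ordinal lt_fs)%:R).
rewrite (bigD1 (Ordinal lt_fs)) //= eqxx mul1r nth_index // big1 ?addr0 //.
by move=> i /negPf ->; rewrite mul0r.
Qed.

Lemma ideal_gen_sub s I :
  is_ideal I -> (forall f, f \in s -> I f) -> ideal_sub (ideal_gen s) I.
Proof.
move=> hI hs _ [c ->]; apply: ideal_sum => // i _.
by apply: ideal_mull => //; apply/hs/mem_nth.
Qed.

Lemma prime_pow P f k : prime_ideal P -> P (f ^+ k) -> P f.
Proof.
case=> hI P1 hM; elim: k => [/P1 //|k IHk]; rewrite exprS.
by case/hM.
Qed.

Lemma prime_prodN P (T : finType) (B : pred T) (F : T -> S) :
  prime_ideal P -> (forall i, B i -> ~ P (F i)) -> ~ P (\prod_(i | B i) F i).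
Proof.
case=> hI P1 hM hF; elim/big_rec: _ => [//|i x Bi nPx].
by case/hM; [apply: hF|].
Qed.

Lemma ideal_ssubP P Q :
  ideal_sub P Q -> (exists2 f, Q f & ~ P f) -> ideal_ssub P Q.
Proof. by move=> PQ [f Qf nPf]; split=> // QP; apply/nPf/QP. Qed.

Lemma ideal_ssub_wit P Q : ideal_ssub P Q -> exists2 f, Q f & ~ P f.
Proof.
case=> _ nQP; apply: NNPP => no; apply: nQP => f Qf.
by apply: NNPP => nPf; apply: no; exists f.
Qed.

End Ideals.

(** * The dimension of a polynomial ring *)

Section Dimension.

Local Open Scope ring_scope.

Variables (K : fieldType) (N : nat).
Local Notation S := {mpoly K[N]}.

(** The polynomials of degree less than [D] form a space of dimension at most
    [D ^ N], so any larger family of them is linearly dependent. *)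
Lemma linear_dependence (T : finType) (D : nat) (F : T -> S) :
  (forall t, (msize (F t) <= D)%N) -> (D ^ N < #|T|)%N ->
  exists2 c : T -> K, (exists t, c t != 0) & \sum_t c t *: F t = 0.
Proof.
move=> sizeF ltDT.
pose X := {ffun 'I_N -> 'I_D}.
pose mon (x : X) : 'X_{1..N} := [multinom (x i : nat) | i < N].
pose A : 'M[K]_(#|T|, #|X|) :=
  \matrix_(i, j) (F (enum_val i))@_(mon (enum_val j)).
have nz : kermx A != 0.
  rewrite kermx_eq0 -row_leq_rank -ltnNge.
  apply: leq_ltn_trans (rank_leq_col _) _.
  by rewrite card_ffun !card_ord.
have [i [j nzij]] : exists i j, kermx A i j != 0.
  apply: NNPP => no; move/eqP: nz => nz; apply/nz/matrixP => i j.
  by rewrite [RHS]mxE; apply/eqP/negPn/negP => nzij; apply: no; exists i, j.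
exists (fun t => kermx A i (enum_rank t)).
  by exists (enum_val j); rewrite enum_valK.
apply/mpolyP => m; rewrite mcoeff0 raddf_sum /=.
have [ltm|gem] := boolP [forall k, (m k < D)%N]; last first.
  rewrite big1 // => t _; rewrite mcoeffZ.
  have [k lek] : exists k, (D <= m k)%N.
    by move: gem; rewrite negb_forall => /existsP[k]; rewrite -leqNgt; exists k.
  rewrite (memN_msupp_eq0 (msize_mdeg_ge _)) ?mulr0 //.
  apply: leq_trans (sizeF t) (leq_trans lek _).
  by rewrite mdegE (bigD1 k) //= leq_addr.
have /forallP ltm' := ltm.
pose x : X := [ffun k => Ordinal (ltm' k)].
have mx : mon x = m by apply/mnmP => k; rewrite mnmE ffunE.
have /matrixP/(_ i (enum_rank x)) := mulmx_ker A.
rewrite mxE [RHS]mxE => ker0; rewrite -[RHS]ker0.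
rewrite [RHS](reindex enum_rank) /=; last first.
  by exists enum_val => ? _; rewrite ?enum_rankK ?enum_valK.
by apply: eq_bigr => t _; rewrite mcoeffZ [A _ _]mxE !enum_rankK mx.
Qed.

Lemma msize_prodX_le (k : nat) (a : 'I_k -> S) (e : 'I_k -> nat) (D d : nat) :
  (forall i, (msize (a i) <= D.+1)%N) -> (forall i, (e i <= d)%N) ->
  (msize (\prod_i a i ^+ e i) <= (k * (d * D)).+1)%N.
Proof.
move=> sa se.
have mulS (p q : S) u v :
    (msize p <= u.+1)%N -> (msize q <= v.+1)%N -> (msize (p * q) <= (u + v).+1)%N.
  have [-> _ _|nzp] := eqVneq p 0; first by rewrite mul0r msize0.
  have [-> _ _|nzq] := eqVneq q 0; first by rewrite mulr0 msize0.
  by rewrite msizeM //; case: (msize p) (msize q) => [|x] [|y] //=; lia.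
have powS (p : S) j : (msize p <= D.+1)%N -> (msize (p ^+ j) <= (j * D).+1)%N.
  move=> sp; elim: j => [|j IHj]; first by rewrite expr0 msize1.
  by rewrite exprS mulSn; apply: mulS.
elim: k a e sa se => [|k IHk] a e sa se; first by rewrite big_ord0 msize1.
rewrite big_ord_recl mulSn; apply: mulS; last exact: IHk.
by apply: leq_trans (powS _ _ (sa _)) _; rewrite ltnS leq_mul2r se orbT.
Qed.

(** Counting: there are [d ^ N.+1] monomials in [N.+1] elements with all
    exponents below [d], while their values lie in a space whose dimension
    grows like [d ^ N] only. *)
Lemma algebraic_dependence (a : 'I_N.+1 -> S) :
  exists (d : nat) (c : {ffun 'I_N.+1 -> 'I_d} -> K), (exists e, c e != 0) /\
    \sum_e c e *: \prod_i a i ^+ e i = 0.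
Proof.
pose D := \max_i msize (a i).
have sa i : (msize (a i) <= D.+1)%N by apply/leqW/(leq_bigmax i).
pose B := (N.+1 * D).+1.
(* [d] exceeds [B ^ N], hence [(d * B) ^ N < d ^ N.+1]. *)
pose d := (B ^ N).+1.
exists d.
have [||c [e nz] c0] := @linear_dependence {ffun 'I_N.+1 -> 'I_d} (d * B)%N
    (fun e => \prod_i a i ^+ e i).
- move=> e; have := @msize_prodX_le _ a (fun i => e i) D (B ^ N)%N sa.
  move/(_ (fun i => ltn_ord (e i))) => h; apply: leq_trans h _.
  by rewrite /d; move: (B ^ N)%N => b; rewrite /B; nia.
- rewrite card_ffun !card_ord expnMn expnS mulnC ltn_pmul2r ?expn_gt0 //.
by exists c; split; [exists e|].
Qed.

(** Choose [a i] in the [i.+1]-st prime but not in the [i]-th, and take an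
    algebraic relation between the [a i].  Restricting it to the terms whose
    exponent of [a 0] is minimal, dividing by that power of [a 0] and reducing
    modulo the next prime gives a relation between [a 1, a 2, ...] there, and so
    on; a single term is left at the end, a nonzero constant in a prime. *)
Lemma no_long_prime_chain (C : nat -> S -> Prop) : ~ prime_chain N.+1 C.
Proof.
move=> hC; have [prC ssC] := hC.
have [a ha] : exists a : 'I_N.+1 -> S,
    forall i : 'I_N.+1, C i.+1 (a i) /\ ~ C i (a i).
  apply: (@fin_all_exists 'I_N.+1 (fun=> S) (fun i g => C i.+1 g /\ ~ C i g)) => i.
  by have [g Cg nCg] := ideal_ssub_wit (ssC i (ltn_ord i)); exists g.
have [d [c [[e0 nze0] c0]]] := algebraic_dependence a.
pose X := {ffun 'I_N.+1 -> 'I_d}.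
pose rel (j : nat) (E : {set X}) :=
  C j (\sum_(e in E) c e *: \prod_(i < N.+1 | (j <= i)%N) a i ^+ e i).
suff main j : (j <= N.+1)%N -> exists E : {set X},
    [/\ exists e, e \in E, forall e, e \in E -> c e != 0,
        forall e e' (i : 'I_N.+1), e \in E -> e' \in E -> (i < j)%N -> e i = e' i
      & rel j E].
  have [E [[e eE] nzE same relE]] := main _ (leqnn _).
  have [idC C1 _] := prC _ (leqnn _); apply: C1.
  have E1 : E = [set e].
    apply/setP => e'; rewrite inE; apply/idP/eqP => [e'E|-> //].
    by apply/ffunP => i; apply: same (ltn_ord i).
  move: relE; rewrite /rel E1 big_set1 big_pred0; last first.
    by move=> i; rewrite leqNgt ltn_ord.
  move/(ideal_mull (c e)^-1%:MP idC).
  by rewrite -alg_mpolyC -scalerAl mul1r scalerA mulVf ?scale1r // nzE.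
elim: j => [_|j IHj lt_jN].
  exists [set e | c e != 0]; split=> [|e|//|].
  - by exists e0; rewrite inE.
  - by rewrite inE.
  rewrite /rel; have [[C0 _] _ _] := prC 0%N (leq0n _).
  suff -> : \sum_(e in [set e | c e != 0]) c e *:
      \prod_(i < N.+1 | (0 <= i)%N) a i ^+ e i =
    \sum_e c e *: \prod_i a i ^+ e i by rewrite c0.
  rewrite [LHS]big_mkcond /=; apply: eq_bigr => e _; rewrite inE.
  by case: eqP => [->|_]; rewrite ?scale0r //.
have [E [[e1 e1E] nzE same relE]] := IHj (ltnW lt_jN).
pose oj : 'I_N.+1 := Ordinal lt_jN.
case: (@arg_minnP X e1 (mem E) (fun e => e oj) e1E) => em emE' minE.
have emE : em \in E := emE'.
have [Cj idj] : prime_ideal (C j) /\ is_ideal (C j).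
  by have pr := prC j (ltnW lt_jN); split=> //; case: pr.
have [_ _ prj] := Cj.
have [idj1 _ _] := prC j.+1 lt_jN.
have [inC notC] := ha oj.
pose G (e : X) := \prod_(i < N.+1 | (j < i)%N) a i ^+ e i.
have splitG (e : X) :
    \prod_(i < N.+1 | (j <= i)%N) a i ^+ e i = a oj ^+ e oj * G e.
  rewrite (bigD1 oj) //=; congr (_ * _); apply: eq_bigl => i.
  by rewrite [(j < i)%N]ltn_neqAle andbC -val_eqE /= eq_sym.
exists [set e in E | e oj == em oj]; split.
- by exists em; rewrite inE emE eqxx.
- by move=> e; rewrite inE => /andP[/nzE].
- move=> e e' i; rewrite !inE => /andP[eE /eqP ee] /andP[e'E /eqP e'e].
  rewrite ltnS leq_eqVlt => /predU1P[ij|ltij]; last exact: same ltij.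
  by rewrite (_ : i = oj) ?ee ?e'e //; apply: val_inj.
have reduced : C j (\sum_(e in E) c e *: (a oj ^+ (e oj - em oj) * G e)).
  have /prj[/(prime_pow Cj)//|//] :
      C j (a oj ^+ em oj * (\sum_(e in E) c e *: (a oj ^+ (e oj - em oj) * G e))).
  rewrite mulr_sumr; move: relE; rewrite /rel.
  congr (C j _); apply: eq_bigr => e eE.
  rewrite splitG -scalerAr mulrA -exprD subnKC //; exact: minE.
have [sub _] := ssC j lt_jN; move/sub: reduced.
rewrite (bigID (fun e : X => e oj == em oj)) /= /rel => relj.
have high : C j.+1 (\sum_(e in E | e oj != em oj)
                      c e *: (a oj ^+ (e oj - em oj) * G e)).
  apply: ideal_sum => // e /andP[eE ne].
  have lt : (em oj < e oj)%N.
    by rewrite ltn_neqAle minE // andbT eq_sym.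
  rewrite -mul_mpolyC; apply: (ideal_mull _ idj1); apply: (ideal_mulr _ idj1).
  by rewrite -(subnSK lt) exprS; apply: ideal_mulr.
have := ideal_subr idj1 relj high; rewrite addrK; congr (C _ _).
rewrite [RHS](eq_bigl (fun e => (e \in E) && (e oj == em oj))); last first.
  by move=> e; rewrite inE.
apply: eq_bigr => e /andP[_ /eqP ->].
by rewrite subnn expr0 mul1r.
Qed.

(** A chain above [I] continues one of length [h] below its first prime. *)
Lemma chain_above_bound (I : S -> Prop) h k C :
  height I h -> prime_chain k C -> ideal_sub I (C 0%N) -> (h + k <= N)%N.
Proof.
move=> [htI _] [prC ssC] IC; have [D [prD ssD] DC] := htI _ (prC 0%N (leq0n _)) IC.
rewrite leqNgt; apply/negP => lt.
(* [D h] and [C 0] are the same prime. *)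
pose F i := if (i <= h)%N then D i else C (i - h)%N.
apply: (@no_long_prime_chain F); split=> i ile; rewrite /F.
  by case: leqP => hi; [apply: prD|apply: prC; lia].
case: (ltngtP i h) => hi.
- exact: ssD.
- by rewrite subSn; [apply: ssC; lia|exact: ltnW].
- rewrite hi subSnn.
  have [sub nsub] : ideal_ssub (C 0%N) (C 1%N) by apply: ssC; lia.
  split=> [g /DC /sub //|CD]; apply: nsub => g /CD; exact: (proj1 (DC g)).
Qed.

End Dimension.

(** * Kernels of substitutions *)

Section Kernels.

Local Open Scope ring_scope.

Variables (K : fieldType) (N M : nat).
Implicit Types (h : 'I_N -> {mpoly K[M]}) (f g : {mpoly K[N]}).

Definition subst_ker h f : Prop := mmap (@mpolyC M K) h f = 0.

Lemma subst_ker_prime h : prime_ideal (subst_ker h).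
Proof.
split; first split.
- exact: mmap0.
- move=> a f g; rewrite /subst_ker rmorphD rmorphM /= => -> ->.
  by rewrite mulr0 addr0.
- by rewrite /subst_ker rmorph1; apply/eqP/oner_neq0.
by move=> f g; rewrite /subst_ker rmorphM /= => /eqP; rewrite mulf_eq0;
   case/orP => /eqP; [left|right].
Qed.

Lemma mmap_var h i : mmap (@mpolyC M K) h 'X_i = h i.
Proof. by rewrite mmapX mmap1U. Qed.

Lemma eq_mmap h h' f : h =1 h' -> mmap (@mpolyC M K) h f = mmap (@mpolyC M K) h' f.
Proof. by move=> e; apply: eq_bigr => m _; congr (_ * _); apply: mmap1_eq. Qed.

End Kernels.

Section Composition.

Local Open Scope ring_scope.

Variables (K : fieldType) (N M L : nat).
Implicit Types (h : 'I_N -> {mpoly K[M]}) (k : 'I_M -> {mpoly K[L]}).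

Lemma mmap_comp h k f :
  mmap (@mpolyC L K) k (mmap (@mpolyC M K) h f) =
  mmap (@mpolyC L K) (fun i => mmap (@mpolyC L K) k (h i)) f.
Proof.
rewrite [mmap (@mpolyC M K) h f]/mmap raddf_sum; apply: eq_bigr => m _.
rewrite /= rmorphM /= mmapC; congr (_ * _).
by rewrite /mmap1 rmorph_prod; apply: eq_bigr => i _; rewrite rmorphXn.
Qed.

Lemma subst_ker_sub h (h' : 'I_N -> {mpoly K[L]}) k :
  (forall i, h' i = mmap (@mpolyC L K) k (h i)) ->
  ideal_sub (subst_ker h) (subst_ker h').
Proof.
by move=> e f hf; rewrite /subst_ker (eq_mmap _ e) -mmap_comp hf mmap0.
Qed.

End Composition.

Section KernelInPrime.

Local Open Scope ring_scope.

Variables (K : fieldType) (N M : nat).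
Variables (h : 'I_N -> {mpoly K[M]}) (w : nat).
Hypotheses (w_gt0 : (0 < w)%N) (h_homog : forall i, h i \is w.-homog).

Lemma mmap_homog d f :
  f \is d.-homog -> mmap (@mpolyC M K) h f \is (d * w).-homog.
Proof.
move=> /dhomogP hf; rewrite /mmap big_seq; apply: rpred_sum => m /hf mdm.
rewrite mul_mpolyC; apply: rpredZ.
have powX i k : h i ^+ k \is (k * w).-homog.
  by rewrite mulnC; apply: dhomogMn.
rewrite -mdm /= mdegE /mmap1 big_distrl /=.
elim/big_rec2: _ => [|i p e _ hp]; first exact: dhomog1.
exact: dhomogM.
Qed.

Lemma subst_ker_pihomog f d :
  subst_ker h f -> subst_ker h (pihomog mdeg d f).
Proof.
rewrite /subst_ker => hf.
have [lt_d|ge_d] := ltnP d (msize f); last first.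
  suff -> : pihomog mdeg d f = 0 by rewrite mmap0.
  rewrite pihomogE big_seq_cond big_pred0 // => m.
  apply/negP => /andP[/msize_mdeg_lt lt_m /eqP md].
  by move: lt_m; rewrite -[mdeg m]/(mdeg m) md ltnNge ge_d.
move: (hf); rewrite {1}[f](@pihomog_partitionE _ _ mdeg (msize f)) //.
rewrite raddf_sum /= => /(congr1 (pihomog mdeg (d * w))).
rewrite raddf0 raddf_sum /= (bigD1 (Ordinal lt_d)) //=.
rewrite (pihomog_dE (mmap_homog (pihomogP mdeg d f))) big1 ?addr0 // => j ne.
apply: pihomog_ne0 (mmap_homog (pihomogP mdeg j f)).
by rewrite eqn_pmul2r // -val_eqE in ne *.
Qed.

(** The kernel of a graded substitution lies in a prime [Q] as soon as the
    substitution can be undone modulo [Q] up to a common factor [D] outside [Q]: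
    on forms of degree [d], undoing it multiplies by [D ^+ d]. *)
Lemma subst_ker_sub_prime (t : 'I_M -> {mpoly K[N]}) (Q : {mpoly K[N]} -> Prop) D :
  prime_ideal Q -> ~ Q D ->
  (forall i, Q (mmap (@mpolyC N K) t (h i) - D * 'X_i)) ->
  ideal_sub (subst_ker h) Q.
Proof.
move=> prQ nQD ht f hf; have [idQ _ mulQ] := prQ.
pose h' i := mmap (@mpolyC N K) t (h i).
have congM a a' b b' : Q (a - a') -> Q (b - b') -> Q (a * b - a' * b').
  move=> Qa Qb; have -> : a * b - a' * b' = b * (a - a') + a' * (b - b') by ring.
  by apply: ideal_addr => //; apply: ideal_mull.
have congX a a' k : Q (a - a') -> Q (a ^+ k - a' ^+ k).
  move=> Qa; elim: k => [|k IHk]; first by rewrite !expr0 subrr; case: idQ.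
  by rewrite !exprS; apply: congM.
have mon (m : 'X_{1..N}) : Q (mmap1 h' m - D ^+ mdeg m * 'X_[m]).
  rewrite mpolyXE_id mdegE -prodrXr -big_split /= /mmap1.
  elim/big_rec2: _ => [|i p q _ Qpq]; first by rewrite subrr; case: idQ.
  by rewrite -exprMn; apply: congM => //; apply: congX; apply: ht.
have form d g : g \is d.-homog -> subst_ker h g -> Q g.
  move=> /dhomogP hg kg; apply: NNPP => nQg.
  have nQD' : ~ Q (D ^+ d) by move=> /(prime_pow prQ).
  suff /mulQ[] : Q (D ^+ d * g) by [].
  apply/(ideal_eqmod idQ (f := mmap (@mpolyC N K) h' g)); last first.
    by rewrite -mmap_comp kg mmap0; case: idQ.
  rewrite {2}[g]mpolyE mulr_sumr /mmap -sumrB big_seq.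
  apply: ideal_sum => // m /hg /= mdm.
  rewrite mul_mpolyC -scalerAr -scalerBr -mul_mpolyC -mdm.
  exact: ideal_mull.
rewrite [f](@pihomog_partitionE _ _ mdeg (msize f)) //.
apply: ideal_sum => // d _; apply: (form d); first exact: pihomogP.
exact: subst_ker_pihomog.
Qed.

End KernelInPrime.

(** * A chain of primes through the prime of a vertex set *)

Section Degenerations.

Local Open Scope ring_scope.

Variables (K : fieldType) (n : nat).
Local Notation M := (n + (n + n))%N.

Definition vertex (z : 'I_(n + n)) : 'I_n :=
  match split z with inl i | inr i => i end.

Definition at_vertex (z : 'I_(n + n)) (r : 'I_n) : 'I_(n + n) :=
  match split z with inl _ => lshift n r | inr _ => rshift n r end.

Lemma split_lshift (m k : nat) (i : 'I_m) : split (lshift k i) = inl i.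
Proof. exact: (unsplitK (inl i)). Qed.

Lemma split_rshift (m k : nat) (i : 'I_k) : split (rshift m i) = inr i.
Proof. exact: (unsplitK (inr i)). Qed.

Lemma vertex_lshift i : vertex (lshift n i) = i.
Proof. by rewrite /vertex split_lshift. Qed.

Lemma vertex_rshift i : vertex (rshift n i) = i.
Proof. by rewrite /vertex split_rshift. Qed.

Lemma at_lshift i r : at_vertex (lshift n i) r = lshift n r.
Proof. by rewrite /at_vertex split_lshift. Qed.

Lemma at_rshift i r : at_vertex (rshift n i) r = rshift n r.
Proof. by rewrite /at_vertex split_rshift. Qed.

Lemma at_vertex_id z : at_vertex z (vertex z) = z.
Proof.
rewrite -[z]splitK; case: (split z) => i /=.
  by rewrite vertex_lshift at_lshift.
by rewrite vertex_rshift at_rshift.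
Qed.

Lemma vertex_at z r : vertex (at_vertex z r) = r.
Proof.
rewrite -[z]splitK; case: (split z) => i /=.
  by rewrite at_lshift vertex_lshift.
by rewrite at_rshift vertex_rshift.
Qed.

Lemma at_at z r r' : at_vertex (at_vertex z r) r' = at_vertex z r'.
Proof.
rewrite -[z]splitK; case: (split z) => i /=; first by rewrite !at_lshift.
by rewrite !at_rshift.
Qed.

Lemma count_vertex (B : pred 'I_n) :
  count (fun z => B (vertex z)) (enum 'I_(n + n)) = (count B (enum 'I_n)).*2.
Proof.
have cnt k (p : pred 'I_k) : count p (enum 'I_k) = (\sum_(i < k) p i)%N.
  by rewrite -sum1_count big_enum_cond /= [LHS]big_mkcond; apply: eq_bigr => i _;
     case: (p i).
rewrite !cnt big_split_ord /= -addnn; congr (_ + _)%N; apply: eq_bigr => i _.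
  by rewrite vertex_lshift.
by rewrite vertex_rshift.
Qed.

Variable rep : 'I_n -> 'I_n.
Implicit Types (mg : seq 'I_n) (kl : seq 'I_M) (z : 'I_(n + n)).

Definition scale_var (i : 'I_n) : 'I_M := lshift (n + n) i.
Definition point_var z : 'I_M := rshift n z.

Definition target mg z : 'I_(n + n) :=
  at_vertex z (if vertex z \in mg then rep (vertex z) else vertex z).

(** The point [(x_i, y_i)] of the plane is written [s_i * (u_i, v_i)]; for [i] in
    [mg] the direction [(u_i, v_i)] is replaced by that of the representative,
    which makes the points of a component parallel, and the variables in [kl] are
    set to zero.  The scales [s_i] make all coordinates forms of degree 2, so
    that the kernel is graded. *)
Definition degeneration mg kl z : {mpoly K[M]} :=
  if (scale_var (vertex z) \in kl) || (point_var (target mg z) \in kl) then 0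
  else 'X_(scale_var (vertex z)) * 'X_(point_var (target mg z)).

Lemma degeneration_homog mg kl z : degeneration mg kl z \is 2.-homog.
Proof.
rewrite /degeneration; case: ifP => _; first exact: dhomog0.
by rewrite -mpolyXD dhomogX /= mdegD !mdeg1.
Qed.

Lemma mpolyXU_neq0 (k : nat) (i : 'I_k) : 'X_i != 0 :> {mpoly K[k]}.
Proof.
by apply/eqP => /(congr1 (mcoeff U_(i))); rewrite mcoeffXU eqxx mcoeff0 => /eqP;
   rewrite oner_eq0.
Qed.

(** Setting one more variable to zero enlarges the kernel, as witnessed by any
    coordinate whose image is a nonzero multiple of that variable. *)
Lemma kill_step mg kl j z :
  (scale_var (vertex z) == j) || (point_var (target mg z) == j) ->
  scale_var (vertex z) \notin kl -> point_var (target mg z) \notin kl ->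
  ideal_ssub (subst_ker (degeneration mg kl))
             (subst_ker (degeneration mg (rcons kl j))).
Proof.
move=> jz nkl1 nkl2; apply: ideal_ssubP; last first.
  exists 'X_z; rewrite /subst_ker mmap_var /degeneration.
    rewrite !mem_rcons !inE !(eq_sym _ j) in jz *.
    by case/orP: jz => ->; rewrite ?orbT.
  rewrite (negPf nkl1) (negPf nkl2) /=; apply/eqP.
  by rewrite mulf_neq0 ?mpolyXU_neq0.
pose k i : {mpoly K[M]} := if i == j then 0 else 'X_i.
apply: (@subst_ker_sub _ _ _ _ _ _ k) => z'.
rewrite /degeneration !mem_rcons !inE.
set a := scale_var _; set b := point_var _.
have [akl|nakl] /= := boolP (a \in kl); first by rewrite mmap0 orbT.
have [bkl|nbkl] /= := boolP (b \in kl); first by rewrite mmap0 !orbT.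
rewrite !orbF rmorphM /= !mmap_var /k.
by case: (a == j); case: (b == j); rewrite /= ?mul0r ?mulr0.
Qed.

(** Once [i] is merged into [r = rep i] the points of [i] and [r] are parallel, so
    the minor [x_i y_r - x_r y_i] enters the kernel; before that the variables
    [u_i] and [v_i] occur at no other vertex, as [i] represents no vertex. *)
Lemma merge_step mg i :
  (forall j, rep (rep j) = rep j) -> rep i != i -> i \notin mg ->
  ideal_ssub (subst_ker (degeneration mg [::]))
             (subst_ker (degeneration (rcons mg i) [::])).
Proof.
move=> repK nri nimg; set r := rep i; have rri : rep r = r by apply: repK.
have nr : (r == i) = false by exact: negPf nri.
have targetr mg' z : vertex z = r -> target mg' z = z.
  by move=> zr; rewrite /target zr rri if_same -zr at_vertex_id.
have degE mg' z : degeneration mg' [::] z =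
    'X_(scale_var (vertex z)) * 'X_(point_var (target mg' z)) by [].
apply: ideal_ssubP; last first.
  exists ('X_(lshift n i) * 'X_(rshift n r) - 'X_(lshift n r) * 'X_(rshift n i));
    rewrite /subst_ker rmorphB !rmorphM /= !mmap_var !degE;
    rewrite !(vertex_lshift, vertex_rshift);
    rewrite (targetr _ (lshift n r)) ?vertex_lshift //;
    rewrite (targetr _ (rshift n r)) ?vertex_rshift //.
    rewrite /target !(vertex_lshift, vertex_rshift) mem_rcons inE eqxx /=.
    by rewrite at_lshift at_rshift; ring.
  rewrite /target !(vertex_lshift, vertex_rshift) (negPf nimg) at_lshift at_rshift.
  (* the first product survives at this point, the second one vanishes *)
  pose v (j : 'I_M) : K :=
    (j \in [:: scale_var i; scale_var r; point_var (lshift n i);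
               point_var (rshift n r)])%:R.
  move/(congr1 (meval v)); rewrite rmorphB !rmorphM /= !mevalXU rmorph0 /v.
  rewrite !inE !eqxx !orbT /= !mul1r -/r.
  have -> : (point_var (lshift n r) == scale_var i) = false by rewrite eq_rlshift.
  have -> : (point_var (lshift n r) == scale_var r) = false by rewrite eq_rlshift.
  have -> : (point_var (lshift n r) == point_var (lshift n i)) = false.
    by rewrite (inj_eq (@rshift_inj _ _)) (inj_eq (@lshift_inj _ _)).
  have -> : (point_var (lshift n r) == point_var (rshift n r)) = false.
    by rewrite (inj_eq (@rshift_inj _ _)) eq_lrshift.
  by rewrite mul0r subr0 => /eqP; rewrite oner_eq0.
(* Rename the direction variables of [i] to those of [r]. *)
pose k (j : 'I_M) : {mpoly K[M]} :=
  match split j with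
  | inl _ => 'X_j
  | inr z => 'X_(point_var (if vertex z == i then at_vertex z r else z))
  end.
apply: (@subst_ker_sub _ _ _ _ _ _ k) => z.
rewrite !degE rmorphM /= !mmap_var /k split_lshift split_rshift.
congr (_ * 'X_(point_var _)); rewrite /target mem_rcons inE.
have [->|nzi] /= := eqVneq (vertex z) i.
  by rewrite (negPf nimg) vertex_at eqxx at_at.
case: ifP => _; rewrite vertex_at; last by rewrite (negPf nzi).
by case: eqP => // ri; move: nri; rewrite -ri repK eqxx.
Qed.

End Degenerations.

Arguments scale_var {n} i.
Arguments point_var {n} z.

Section ComponentChain.

Local Open Scope ring_scope.

Variables (K : fieldType) (n : nat) (rep : 'I_n -> 'I_n) (T : {set 'I_n}).
Hypotheses (repK : forall i, rep (rep i) = rep i)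
  (repT : forall i, i \in T -> rep i = i)
  (repNT : forall i, i \notin T -> rep i \notin T).

Definition merged := [seq i <- enum 'I_n | rep i != i].
Definition killedT := [seq point_var z | z <- enum 'I_(n + n) & vertex z \in T].
(** The first block leads to the prime of [T]; the scales of the merged vertices
    come before the directions of their representatives, because all points of a
    component vanish with the direction of its representative. *)
Definition killed := killedT ++ [seq scale_var i | i <- merged] ++
  [seq point_var z | z <- enum 'I_(n + n) & (rep (vertex z) == vertex z)
                                             && (vertex z \notin T)].

Lemma size_merged_killed : (size merged + size killed = n + n)%N.
Proof.
rewrite !size_cat !size_map !size_filter addnCA !addnA.
have E (p q : pred 'I_(n + n)) : (forall z, ~~ (p z && q z)) ->
    (count p (enum 'I_(n + n)) + count q (enum 'I_(n + n)))%N =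
    count (predU p q) (enum 'I_(n + n)).
  move=> dis; rewrite -count_predUI (@eq_count _ (predI p q) pred0).
    by rewrite count_pred0 addn0.
  by move=> z /=; apply/negbTE/dis.
set cM := count _ (enum 'I_n).
have -> : (count (fun z : 'I_(n + n) => vertex z \in T) (enum 'I_(n + n)) + cM + cM +
    count (fun z : 'I_(n + n) => (rep (vertex z) == vertex z) && (vertex z \notin T))
      (enum 'I_(n + n)) =
    cM.*2 + count (fun z : 'I_(n + n) => rep (vertex z) == vertex z)
      (enum 'I_(n + n)))%N.
  rewrite -addnn -(addnA _ cM cM) [(_ + (cM + cM))%N]addnC -addnA E.
    congr (_ + _)%N; apply: eq_count => z /=.
    by have [zT|_] := boolP (vertex z \in T); rewrite ?andbT // repT ?eqxx.
  by move=> z; rewrite andbCA andbN andbF.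
rewrite (@count_vertex n (fun i => rep i == i)) -doubleD /cM.
have -> : count (fun i => rep i == i) (enum 'I_n) =
          count (predC (fun i => rep i != i)) (enum 'I_n).
  by apply: eq_count => i /=; rewrite negbK.
by rewrite count_predC size_enum_ord addnn.
Qed.

Definition component_chain (k : nat) : {mpoly K[n + n]} -> Prop :=
  subst_ker (degeneration K rep (take k merged) (take (k - size merged) killed)).

Lemma target_merged z :
  target rep merged z = at_vertex z (rep (vertex z)).
Proof.
by rewrite /target mem_filter mem_enum andbT; case: eqP => //= ->.
Qed.

Lemma point_var_inj : injective (@point_var n).
Proof. exact: rshift_inj. Qed.

Lemma scale_var_inj : injective (@scale_var n).
Proof. exact: lshift_inj. Qed.

Lemma scale_notin_point (i : 'I_n) (s : seq 'I_(n + n)) :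
  scale_var i \notin [seq point_var z | z <- s].
Proof. by apply/mapP => -[z _ /eqP]; rewrite eq_lrshift. Qed.

Lemma point_notin_scale z (s : seq 'I_n) :
  point_var z \notin [seq scale_var i | i <- s].
Proof. by apply/mapP => -[i _ /eqP]; rewrite eq_rlshift. Qed.

Lemma uniq_killed : uniq killed.
Proof.
rewrite !cat_uniq has_cat negb_or !(map_inj_uniq point_var_inj).
rewrite (map_inj_uniq scale_var_inj) !(filter_uniq _ (enum_uniq _)).
rewrite ?andTb ?andbT -?andbA.
apply/and3P; split.
- by rewrite -all_predC; apply/allP => j /mapP[i _ ->]; apply: scale_notin_point.
- rewrite -all_predC; apply/allP => j /mapP[z].
  rewrite mem_filter => /andP[/andP[_ nT] _] ->.
  apply/mapP => -[z']; rewrite mem_filter => /andP[zT _] /point_var_inj zz'.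
  by rewrite zz' zT in nT.
- rewrite -all_predC; apply/allP => j /mapP[z _ ->].
  exact: point_notin_scale.
Qed.

(** The variables are killed in an order in which each of them still divides
    the image of some coordinate when its turn comes. *)
Lemma killed_witness k : (k < size killed)%N ->
  forall j0, exists2 z, (scale_var (vertex z) == nth j0 killed k)
      || (point_var (target rep merged z) == nth j0 killed k)
    & (scale_var (vertex z) \notin take k killed) &&
      (point_var (target rep merged z) \notin take k killed).
Proof.
move=> ltk j0; set j := nth j0 killed k.
have jN : j \notin take k killed.
  move: uniq_killed; rewrite -{1}(cat_take_drop k killed) (drop_nth j0 ltk).
  by rewrite cat_uniq /= negb_or => /and3P[_ /andP[]].
have sub i : i \in take k killed -> i \in killed by apply: mem_take.
have jin : j \in killed by apply: mem_nth.
have fixed z : rep (vertex z) = vertex z -> j = point_var z ->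
    exists2 z, (scale_var (vertex z) == j) || (point_var (target rep merged z) == j)
    & (scale_var (vertex z) \notin take k killed) &&
      (point_var (target rep merged z) \notin take k killed).
  move=> rz jz; exists z; rewrite target_merged rz at_vertex_id -jz ?eqxx ?orbT //.
  rewrite jN andbT; apply/negP => /sub; rewrite !mem_cat.
  rewrite (negPf (scale_notin_point _ _)) orbC (negPf (scale_notin_point _ _)) /=.
  rewrite (mem_map scale_var_inj) mem_filter rz eqxx //.
move: (jin); rewrite !mem_cat => /or3P[] /mapP[].
- by move=> z; rewrite mem_filter => /andP[zT _]; apply: fixed; apply: repT.
- move=> i iM ji; exists (lshift n i); rewrite vertex_lshift ?ji ?eqxx //.
  rewrite -ji jN target_merged vertex_lshift at_lshift.
  have niT : i \notin T.
    apply/negP => iT; move: iM; rewrite mem_filter repT // eqxx //.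
  have ltks : (k < size (killedT ++ [seq scale_var i | i <- merged]))%N.
    rewrite ltnNge; apply/negP => gek.
    have : j \in [seq point_var z | z <- enum 'I_(n + n) &
        (rep (vertex z) == vertex z) && (vertex z \notin T)].
      move: ltk; rewrite /j /killed catA nth_cat ifN -?leqNgt // size_cat => ltk.
      by apply: mem_nth; rewrite ltn_subLR.
    by rewrite ji (negPf (scale_notin_point _ _)).
  rewrite /killed catA takel_cat ?(ltnW ltks) //=.
  apply/negP => /mem_take; rewrite mem_cat (negPf (point_notin_scale _ _)) orbF.
  rewrite (mem_map point_var_inj) mem_filter vertex_lshift.
  by rewrite (negPf (repNT niT)).
- by move=> z; rewrite mem_filter => /andP[/andP[/eqP rz _] _]; apply: fixed.
Qed.

Lemma component_chainP : prime_chain (n + n) component_chain.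
Proof.
split=> [k _|k ltk]; first exact: subst_ker_prime.
have [ltkM|geMk] := ltnP k (size merged).
  have i0 : 'I_n by move: ltkM; case: merged.
  rewrite /component_chain (eqP (ltnW ltkM)) (eqP ltkM) !take0.
  rewrite (take_nth i0 ltkM); set i := nth i0 merged k.
  have : i \in merged by apply: mem_nth.
  rewrite mem_filter => /andP[nri _]; apply: merge_step => //.
  have := filter_uniq (fun i => rep i != i) (enum_uniq 'I_n).
  rewrite -/merged -{1}(cat_take_drop k merged) (drop_nth i0 ltkM).
  by rewrite cat_uniq /= negb_or => /and3P[_ /andP[]].
rewrite /component_chain (take_oversize geMk) (take_oversize (leqW geMk)) subSn //.
have ltkK : (k - size merged < size killed)%N.
  by rewrite ltn_subLR // size_merged_killed.
have j0 : 'I_(n + (n + n)) by move: ltkK; case: killed.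
rewrite (take_nth j0 ltkK).
by have [z jz /andP[]] := killed_witness ltkK j0; apply: kill_step.
Qed.

(** The position of the prime of [T] in the chain: all merges are done and the
    points of [T] are zero. *)
Definition component_pos := (size merged + size killedT)%N.

Lemma component_pos_le : (component_pos <= n + n)%N.
Proof.
by rewrite -size_merged_killed /killed size_cat leq_add2l leq_addr.
Qed.

Definition component_param z : {mpoly K[n + (n + n)]} :=
  if vertex z \in T then 0
  else 'X_(scale_var (vertex z)) * 'X_(point_var (at_vertex z (rep (vertex z)))).

Lemma component_paramE z :
  degeneration K rep merged killedT z = component_param z.
Proof.
rewrite /degeneration target_merged (negPf (scale_notin_point _ _)) /=.
rewrite (mem_map point_var_inj) mem_filter mem_enum andbT vertex_at /component_param.
have [zT|nzT] := boolP (vertex z \in T); first by rewrite repT // zT.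
by rewrite (negPf (repNT nzT)).
Qed.

Lemma component_chain_pos :
  component_chain component_pos =
  subst_ker (degeneration K rep merged killedT).
Proof.
rewrite /component_chain /component_pos addKn take_oversize ?leq_addr //.
by rewrite take_size_cat.
Qed.

End ComponentChain.

(** * Prime chains above a binomial edge ideal *)

Section EdgeIdeal.

Local Open Scope ring_scope.

Variables (K : fieldType) (n : nat) (E : rel 'I_n).
Hypotheses (E_sym : ssrbool.symmetric E) (E_irr : irreflexive E).
Local Notation S := {mpoly K[n + n]}.
Local Notation J := (binomial_edge_ideal K E).

Definition minor (i j : 'I_n) : S := xvar K i * yvar K j - xvar K j * yvar K i.

Lemma edge_ideal_is_ideal : is_ideal J.
Proof. exact: ideal_gen_is_ideal. Qed.

Lemma minor_in_edge_ideal i j : E i j -> J (minor i j).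
Proof.
wlog lt_ij : i j / (i < j)%N.
  move=> wl Eij; have [lt_ij|lt_ji|/val_inj ij] := ltngtP i j; first exact: wl.
    have -> : minor i j = - minor j i by rewrite /minor; ring.
    by apply: ideal_opp (edge_ideal_is_ideal) _; apply: wl; rewrite // E_sym.
  by rewrite ij E_irr in Eij.
move=> Eij; apply: mem_ideal_gen; apply/mapP; exists (i, j) => //.
by rewrite mem_enum inE /= lt_ij.
Qed.

Lemma edge_ideal_min (I : S -> Prop) : is_ideal I ->
  (forall i j, E i j -> I (minor i j)) -> ideal_sub J I.
Proof.
move=> idI hI; apply: ideal_gen_sub => // f /mapP[[i j]].
by rewrite mem_enum inE /= => /andP[_ Eij] ->; apply: hI.
Qed.

Section AbovePrime.

Variables (Q : S -> Prop) (T : {set 'I_n}).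
Hypotheses (prQ : prime_ideal Q) (JQ : ideal_sub J Q)
  (TP : forall i, i \in T <-> Q (xvar K i) /\ Q (yvar K i)).

Let e : rel 'I_n := [rel i j | [&& E i j, i \notin T & j \notin T]].
Let rep := fingraph.root e.

Let e_sym : connect_sym e.
Proof.
apply: sym_connect_sym => i j.
by rewrite /e /= E_sym [(i \notin T) && _]andbC.
Qed.

Let repK i : rep (rep i) = rep i.
Proof. exact: root_root. Qed.

Let closedT : closed e (mem T).
Proof. by move=> i j /and3P[_ /negPf iT /negPf jT]; exact: etrans iT (esym jT). Qed.

Let repNT i : i \notin T -> rep i \notin T.
Proof. by have /= <- := closed_connect closedT (connect_root e i). Qed.

Let repT i : i \in T -> rep i = i.
Proof.
move=> iT; have /connectP[[|j p] /=] := connect_root e i; first by [].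
by rewrite {1}/e /= iT andbF.
Qed.

(** Parallelism passes along an edge [i -- k] and on from [k], because the point
    of a vertex [k] outside [T] is nonzero modulo [Q]. *)
Lemma minor_connect i j : connect e i j -> Q (minor i j).
Proof.
have [idQ _ mulQ] := prQ.
case/connectP => p; elim: p i => [|k p IHp] i /= => [_ ->|].
  by rewrite /minor subrr; case: idQ.
case/andP => /and3P[Eik _ kT] pth jE.
have Qik := JQ (minor_in_edge_ideal Eik).
have Qkj := IHp _ pth jE.
have Qx : Q (xvar K k * minor i j).
  have -> : xvar K k * minor i j = xvar K i * minor k j + xvar K j * minor i k.
    by rewrite /minor; ring.
  by apply: ideal_addr => //; apply: ideal_mull.
have Qy : Q (yvar K k * minor i j).
  have -> : yvar K k * minor i j = yvar K j * minor i k + yvar K i * minor k j.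
    by rewrite /minor; ring.
  by apply: ideal_addr => //; apply: ideal_mull.
case/mulQ: Qx => // Qx; case/mulQ: Qy => // Qy.
by move: kT => /negP[]; apply/TP.
Qed.

Let pos := component_pos rep T.
Let C := @component_chain K n rep T.

Lemma edge_ideal_sub_component : ideal_sub J (C pos).
Proof.
rewrite /C component_chain_pos.
apply: edge_ideal_min => [|i j Eij].
  by case: (subst_ker_prime (degeneration K rep (merged rep) (killedT T))).
rewrite /subst_ker /minor rmorphB !rmorphM /= !mmap_var.
rewrite !(component_paramE K repT repNT) /component_param.
rewrite !(vertex_lshift, vertex_rshift, at_lshift, at_rshift).
have [_|iT] := boolP (i \in T); first by rewrite !(mul0r, mulr0) subr0.
have [_|jT] := boolP (j \in T); first by rewrite !(mul0r, mulr0) subr0.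
have -> : rep j = rep i.
  by apply/esym/eqP; rewrite /rep root_connect //; apply: connect1; apply/and3P.
by ring.
Qed.

Let coord (b : bool) (i : 'I_n) : S := if b then xvar K i else yvar K i.

(** Modulo [Q] the points of a component are multiples of the nonzero point of its
    representative, so the parametrization can be undone up to denominators. *)
Lemma component_sub_prime : ideal_sub (C pos) Q.
Proof.
rewrite /C component_chain_pos; have [idQ _ mulQ] := prQ.
have [sel selP] : exists sel : 'I_n -> bool,
    forall r, r \notin T -> ~ Q (coord (sel r) r).
  apply: (@fin_all_exists 'I_n (fun=> bool)
           (fun r b => r \notin T -> ~ Q (coord b r))) => r.
  have [Qx|nQx] := classic (Q (xvar K r)); last by exists true.
  by exists false => /negP rT Qy; apply/rT/TP.
pose c i := coord (sel (rep i)) i.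
(* Modulo [Q] the point of [i] is [c i / c (rep i)] times that of [rep i];
   multiplying by the common denominator [D] clears these fractions. *)
pose D := \prod_(j | j \notin T) c (rep j).
pose t (j : 'I_(n + (n + n))) : S :=
  match split j with
  | inl i => c i * \prod_(j | (j \notin T) && (j != i)) c (rep j)
  | inr z => 'X_z
  end.
apply: (@subst_ker_sub_prime _ _ _ _ 2 _ _ t Q D) => //.
- exact: degeneration_homog.
- by apply: prime_prodN => // j jT; rewrite /c repK; apply/selP/repNT.
move=> z; rewrite component_paramE // /component_param.
have [zT|zT] := boolP (vertex z \in T).
  rewrite mmap0 sub0r -mulrN; apply: (ideal_mull _ idQ); apply: (ideal_opp idQ).
  have [Qx Qy] := proj1 (TP _) zT.
  rewrite -[z]at_vertex_id /at_vertex; by case: split.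
rewrite rmorphM /= !mmap_var /t split_lshift split_rshift /D.
rewrite (bigD1 (vertex z) zT) /=; set P := \prod_(j | _) _.
set r := rep (vertex z).
have -> : c (vertex z) * P * 'X_(at_vertex z r) - c r * P * 'X_z =
    P * (c (vertex z) * 'X_(at_vertex z r) - c r * 'X_z) by ring.
apply: ideal_mull => //.
have Qm : Q (minor (vertex z) r) by apply/minor_connect/connect_root.
have rr : rep r = r by apply: repK.
rewrite -[in 'X_z](at_vertex_id z) /c rr -/r /coord /at_vertex /xvar /yvar.
case: (split z) => i; case: (sel r).
- by rewrite mulrC subrr; case: idQ.
- rewrite -opprB; apply: ideal_opp => //; move: Qm; rewrite /minor /xvar /yvar.
  by congr Q; ring.
- exact: Qm.
- by rewrite mulrC subrr; case: idQ.
Qed.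

(** The part of the chain before [pos] lies below [Q] and has length at most [h],
    which leaves length at least [n + n - h] for the part starting at [pos]. *)
Lemma edge_ideal_chain_of_prime h :
  (forall k, prime_height_ge Q k -> (k <= h)%N) ->
  exists2 C' : nat -> S -> Prop, prime_chain (n + n - h) C' & ideal_sub J (C' 0%N).
Proof.
move=> htQ; have chC : prime_chain (n + n) C by apply: component_chainP.
have [prC ssC] := chC.
have le_pos : (pos <= n + n)%N by apply: component_pos_le.
have le_posh : (pos <= h)%N.
  apply: htQ; exists (fun k => if (k < pos)%N then C k else Q); last first.
    by move=> g; rewrite ltnn.
  split=> k lek; first by case: ifP => // _; apply/prC/(leq_trans lek).
  rewrite lek; have [subk nsub] := ssC k (leq_trans lek le_pos).
  case: ltnP => // ge_pos; have Ek : k.+1 = pos by apply/eqP; rewrite eqn_leq lek.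
  rewrite Ek in subk nsub; split=> [g Cg|QC].
    exact/component_sub_prime/subk.
  by apply: nsub => g Cg; apply/QC/component_sub_prime.
exists (fun k => C (pos + k)%N); last first.
  by rewrite addn0; apply: edge_ideal_sub_component.
have lek k : (k <= n + n - h -> pos + k <= n + n)%N by lia.
by split=> k kle; [apply/prC/lek|rewrite addnS; apply/ssC; have := lek _ kle; lia].
Qed.

End AbovePrime.

Lemma edge_ideal_chain h : height J h ->
  exists2 C : nat -> S -> Prop, prime_chain (n + n - h) C & ideal_sub J (C 0%N).
Proof.
move=> [_ [Q [prQ JQ htQ]]].
have [b bP] : exists b : 'I_n -> bool,
    forall i, b i <-> Q (xvar K i) /\ Q (yvar K i).
  apply: (@fin_all_exists 'I_n (fun=> bool)
           (fun i b => b <-> Q (xvar K i) /\ Q (yvar K i))) => i.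
  have [Qi|nQi] := classic (Q (xvar K i) /\ Q (yvar K i)).
    by exists true; split.
  by exists false; split.
apply: (@edge_ideal_chain_of_prime Q [set i | b i]) htQ => // i.
by rewrite inE; apply: bP.
Qed.

Lemma edge_ideal_krull_dim h :
  height J h -> krull_dim_quot J (n + n - h).
Proof.
move=> htJ; split; first exact: edge_ideal_chain.
by move=> k C chC JC; have := chain_above_bound htJ chC JC; lia.
Qed.

End EdgeIdeal.

(** * Homogeneous generators *)

Definition coprime_mnm N (m1 m2 : 'X_{1..N}) : bool :=
  [forall k, (m1 k == 0%N) || (m2 k == 0%N)].

Section HomogeneousGenerators.

Local Open Scope ring_scope.

Variables (K : fieldType) (N : nat).
Local Notation S := {mpoly K[N]}.
Implicit Types (f g c : S) (s : seq S) (m : 'X_{1..N}).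

(** Multiplying [g] by a form of positive degree only produces monomials of
    degree above [d]. *)
Lemma mcoeffM_homog c g d m : g \is d.-homog -> (mdeg m <= d)%N ->
  (c * g)@_m = c@_0 * g@_m.
Proof.
move=> hg le_md; elim/mpolyind: c => [|a m1 p _ _ IHp].
  by rewrite mul0r !mcoeff0 mul0r.
rewrite mulrDl !mcoeffD IHp mulrDl -scalerAl !mcoeffZ mcoeffX; congr (_ + _).
have [->|nz] := eqVneq m1 0%MM; first by rewrite mpolyX0 mul1r mulr1.
have hX : 'X_[m1] * g \is (mdeg m1 + d).-homog by rewrite dhomogM // dhomogX.
rewrite (dhomog_nemf_coeff hX) ?(mulr0, mul0r) //=.
rewrite -mdeg_eq0 -lt0n in nz.
by rewrite neq_ltn (leq_ltn_trans le_md) // -[X in (X < _)%N]add0n ltn_add2r.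
Qed.

(** In the lowest degree only the constant terms of the multipliers matter. *)
Lemma ideal_gen_coeff s d f : {in s, forall g, g \is d.-homog} ->
  ideal_gen s f -> exists c : 'I_(size s) -> K, forall m, (mdeg m <= d)%N ->
    f@_m = \sum_(i < size s) c i * (s`_i)@_m.
Proof.
move=> hs [c ->]; exists (fun i => (c i)@_0) => m le_md.
rewrite raddf_sum /=; apply: eq_bigr => i _; apply: mcoeffM_homog le_md.
by apply/hs/mem_nth.
Qed.

Lemma ideal_gen_coeff_lt s d f m : {in s, forall g, g \is d.-homog} ->
  ideal_gen s f -> (mdeg m < d)%N -> f@_m = 0.
Proof.
move=> hs /(ideal_gen_coeff hs)[c cP] lt_md.
rewrite cP ?(ltnW lt_md) // big1 // => i _.
have hi : s`_i \is d.-homog by apply/hs/mem_nth.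
by rewrite (dhomog_nemf_coeff hi) ?mulr0 //= neq_ltn lt_md.
Qed.

Lemma pihomogM_homog c g d e : g \is e.-homog ->
  exists2 c', pihomog mdeg d (c * g) = c' * g & (d < e)%N -> c' = 0.
Proof.
move=> hg; exists (\sum_(k < msize c | (k + e)%N == d) pihomog mdeg k c); last first.
  by move=> lt_de; rewrite big_pred0 // => k; lia.
rewrite {1}[c](@pihomog_partitionE _ _ mdeg (msize c)) // mulr_suml raddf_sum /=.
rewrite mulr_suml [RHS]big_mkcond; apply: eq_bigr => k _.
have hk : pihomog mdeg k c * g \is (k + e).-homog by rewrite dhomogM // pihomogP.
by case: eqP => [<-|/eqP ne]; [rewrite pihomog_dE|rewrite (pihomog_ne0 ne)].
Qed.

(** Only the generators of degree at most [d] contribute to the degree [d] part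
    of the ideal, so a generator of larger degree could be omitted; and the ideal
    has no nonzero form of degree less than [d]. *)
Lemma minimal_generator_homog (I : S -> Prop) (gens s : seq S) d :
  {in gens, forall g, g \is d.-homog} -> (forall g, I g <-> ideal_gen gens g) ->
  minimal_generators I s -> {in s, forall g, g != 0 /\ g \is d.-homog}.
Proof.
move=> hgens Igens [hs gen_s min_s] g gs.
have lt_gs : (index g s < size s)%N by rewrite index_mem.
set j := index g s in lt_gs; pose s' := take j s ++ drop j.+1 s.
have sub' f : f \in s' -> f \in s.
  by rewrite mem_cat => /orP[/mem_take|/mem_drop].
have mem_s f : f \in s -> f = g \/ f \in s'.
  rewrite -{1}(cat_take_drop j s) (drop_nth 0 lt_gs) nth_index //.
  rewrite mem_cat inE orbCA => /predU1P[|fs']; [by left|right].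
  by rewrite mem_cat.
have id' := ideal_gen_is_ideal s'.
have redundant : ~ ideal_sub I (ideal_gen s').
  move=> sub; apply: (min_s j lt_gs) => f; split; first exact: sub.
  apply: ideal_gen_sub => [|f' /sub' fs]; last exact/gen_s/mem_ideal_gen.
  have [I0 IA] := ideal_gen_is_ideal s.
  by split=> [|a f1 f2 /gen_s I1 /gen_s I2]; apply/gen_s => //; apply: IA.
have nzg : g != 0.
  apply/eqP => g0; apply: redundant => f /gen_s; apply: ideal_gen_sub => // f'.
  by case/mem_s => [->|/mem_ideal_gen //]; rewrite g0; case: id'.
split=> //; have [e he] := hs g gs.
have [lt_ed|lt_de|ed] := ltngtP e d; last by rewrite -ed.
  case/eqP: nzg; apply/mpolyP => m; rewrite mcoeff0.
  have [me|ne] := eqVneq (mdeg m) e; last exact: dhomog_nemf_coeff ne.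
  by apply: (ideal_gen_coeff_lt hgens) (_ : mdeg m < d)%N;
     [apply/Igens/gen_s/mem_ideal_gen|rewrite me].
exfalso; apply: redundant => f /Igens; apply: ideal_gen_sub => // h hh.
have /Igens/gen_s[c hE] := mem_ideal_gen hh.
rewrite -(pihomog_dE (hgens h hh)) hE raddf_sum /=; apply: ideal_sum => // i _.
have si : s`_i \in s by apply: mem_nth.
have [ei hi] := hs _ si.
case: (mem_s _ si) => [E|s'i].
  rewrite E.
  by have [c'' -> ->] := pihomogM_homog (c i) d he; rewrite // mul0r; case: id'.
have [c' -> _] := pihomogM_homog (c i) d hi.
by apply: ideal_mull id' _; apply: mem_ideal_gen.
Qed.

(** If an earlier and a later monomial shared a variable, the earlier one divided
    by it would be killed by the later one modulo the ideal of the preceding ones;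
    but its degree is [d - 1], so it does not lie in that ideal. *)
Lemma regular_monomials_coprime (us : seq 'X_{1..N}) d :
  {in us, forall m, mdeg m = d} -> regular_sequence [seq 'X_[K, m] | m <- us] ->
  pairwise (@coprime_mnm N) us.
Proof.
move=> du [reg _]; apply/(pairwiseP 0%MM) => i j.
rewrite !inE => lt_i lt_j lt_ij; apply/forallP => k; apply: contraT.
rewrite negb_or => /andP[nzi nzj].
set mi := nth _ us i in nzi; set mj := nth _ us j in nzj.
have splitk m : m k != 0%N -> m = (m - U_(k) + U_(k))%MM.
  by rewrite -lep1mP => /submK.
have Xsplit m : m k != 0%N -> 'X_[m] = 'X_[m - U_(k)] * 'X_k :> S.
  by move=> nz; rewrite -mpolyXD -splitk.
rewrite size_map in reg.
have := reg j lt_j 'X_[mi - U_(k)].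
rewrite -map_take (nth_map 0%MM) // -/mj.
have hus : {in [seq 'X_[K, m] | m <- take j us], forall g, g \is d.-homog}.
  by move=> g /mapP[m /mem_take /du dm ->]; rewrite dhomogX /= dm.
case=> [|c].
  rewrite (_ : _ * _ = 'X_[mj - U_(k)] * 'X_[mi]); last first.
    by rewrite (Xsplit mj nzj) (Xsplit mi nzi) mulrCA.
  apply: (ideal_mull _ (ideal_gen_is_ideal _)); apply/mem_ideal_gen/map_f.
  by rewrite /mi -(nth_take _ lt_ij) mem_nth // size_take lt_j.
move=> E; have Xin : ideal_gen [seq 'X_[K, m] | m <- take j us] 'X_[mi - U_(k)].
  by exists c.
have dmi : mdeg mi = d by apply/du/mem_nth.
have lt_d : (mdeg (mi - U_(k))%MM < d)%N.
  by rewrite -dmi {2}(splitk mi nzi) mdegD mdeg1 addn1.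
have := ideal_gen_coeff_lt hus Xin lt_d; rewrite mcoeffX eqxx => /eqP.
by rewrite oner_eq0.
Qed.

End HomogeneousGenerators.

(** * Initial monomials *)

Section MonomialOrder.

Variables (K : fieldType) (N : nat) (le : rel 'X_{1..N}).
Hypothesis le_mon : monomial_order le.
Implicit Types (m : 'X_{1..N}) (f : {mpoly K[N]}).

Lemma in_expP f : f != 0%R ->
  in_exp le f \in msupp f /\ {in msupp f, forall m, le m (in_exp le f)}.
Proof.
have [[le_refl le_anti le_trans le_total] [le0 _]] := le_mon.
rewrite -msupp_eq0 /in_exp; elim: (msupp f) => [//|m s IHs] _ /=.
have [->|nzs] := eqVneq s [::].
  rewrite /=; have [le_m0|nle] := boolP (le m 0%MM).
    have -> : m = 0%MM by apply: le_anti; rewrite le_m0 le0.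
    by split=> [|m']; rewrite inE // => /eqP ->.
  by split=> [|m']; rewrite inE // => /eqP ->.
have [ins les] := IHs nzs; set t := foldr _ _ s in ins les *.
have [le_mt|nle] := boolP (le m t).
  split=> [|m']; first by rewrite inE ins orbT.
  by rewrite inE => /predU1P[->|/les].
have le_tm : le t m by have := le_total m t; rewrite (negPf nle).
split=> [|m']; first by rewrite inE eqxx.
by rewrite inE => /predU1P[->|/les /le_trans -> //]; apply: le_refl.
Qed.

Lemma le_addm_cancel m1 m2 m : le (m1 + m)%MM (m2 + m)%MM -> le m1 m2.
Proof.
have [[le_refl le_anti le_trans le_total] [_ leD]] := le_mon.
move=> le12; have /orP[//|le21] := le_total m1 m2.
have /addIm -> // : (m1 + m)%MM = (m2 + m)%MM.
by apply: le_anti; rewrite le12 leD.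
Qed.

End MonomialOrder.

(** * Systems of parameters attached to edge monomials *)

Section AttachedSequence.

Local Open Scope ring_scope.

Lemma enum_ord_filter_sorted (N : nat) (B : pred 'I_N) :
  sorted (fun i j : 'I_N => i < j)%N [seq k <- enum 'I_N | B k].
Proof.
apply: sorted_filter; first by move=> i j k; apply: ltn_trans.
by have := iota_ltn_sorted 0 N; rewrite -val_enum_ord sorted_map.
Qed.

(** Pairwise coprime monomials involve disjoint sets of variables. *)
Lemma count_pairwise_coprime (N : nat) (us : seq 'X_{1..N}) d :
  {in us, forall m : 'X_{1..N}, count (fun k => m k != 0%N) (enum 'I_N) = d} ->
  pairwise (@coprime_mnm N) us ->
  (count (fun k => all (fun m : 'X_{1..N} => m k == 0%N) us) (enum 'I_N) +
    size us * d = N)%N.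
Proof.
elim: us => [|m us IHus] cnt /=.
  by move=> _; rewrite count_predT size_enum_ord addn0.
case/andP=> /allP dis pw; rewrite -[RHS]IHus //; last first.
  by move=> m' m'us; apply: cnt; rewrite inE m'us orbT.
rewrite mulSn addnA; congr (_ + _)%N.
rewrite -(cnt m) ?mem_head // -count_predUI addnC [X in (X + _)%N](_ : _ = 0%N).
  rewrite add0n; apply: eq_count => k /=; have [mk|nmk] := eqVneq (m k) 0%N.
    by rewrite orbF.
  by apply/esym/allP => m' /dis /forallP/(_ k); rewrite (negPf nmk).
rewrite -(count_pred0 (enum 'I_N)); apply: eq_count => k /=.
by case: eqP; rewrite ?andbF.
Qed.

Variables (K : fieldType) (n : nat).
Local Notation S := {mpoly K[n + n]}.

Definition edge_mnm (a b : 'I_n) : 'X_{1..n + n} :=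
  (U_(lshift n a) + U_(rshift n b))%MM.

Lemma edge_mnmE a b z : edge_mnm a b z = ((lshift n a == z) + (rshift n b == z))%N.
Proof. by rewrite mnmDE !mnm1E. Qed.

Lemma edge_mnm_inj a b a' b' : edge_mnm a b = edge_mnm a' b' -> a = a' /\ b = b'.
Proof.
move/mnmP => e; split.
  move: (e (lshift n a)).
  rewrite !edge_mnmE eqxx !eq_rlshift (inj_eq (@lshift_inj _ _)).
  by rewrite eq_sym; case: eqP.
move: (e (rshift n b)).
rewrite !edge_mnmE eqxx !eq_lrshift (inj_eq (@rshift_inj _ _)).
by rewrite eq_sym; case: eqP.
Qed.

Lemma edge_mnm_support a b :
  [seq k <- enum 'I_(n + n) | (0 < edge_mnm a b k)%N] = [:: lshift n a; rshift n b].
Proof.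
apply: (irr_sorted_eq (leT := fun i j : 'I_(n + n) => (i < j)%N)).
- by move=> i j k; apply: ltn_trans.
- by move=> i; rewrite ltnn.
- exact: enum_ord_filter_sorted.
- by rewrite /= andbT; apply: leq_trans (ltn_ord a) _; apply: leq_addr.
move=> k; rewrite mem_filter mem_enum andbT edge_mnmE !inE addn_gt0 !lt0b.
by rewrite !(eq_sym k).
Qed.

End AttachedSequence.

(** * The attached sequence of a sequence of König type *)

Section KoenigType.

Local Open Scope ring_scope.

Variables (K : fieldType) (n : nat) (E : rel 'I_n).
Hypotheses (E_sym : ssrbool.symmetric E) (E_irr : irreflexive E).
Local Notation S := {mpoly K[n + n]}.
Local Notation J := (binomial_edge_ideal K E).

Lemma edge_mnm_eq (a b a' b' : 'I_n) :
  (edge_mnm a b == edge_mnm a' b') = (a == a') && (b == b').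
Proof.
by apply/eqP/andP => [/edge_mnm_inj[-> ->]|[/eqP-> /eqP->]].
Qed.

Lemma mdeg_edge_mnm (a b : 'I_n) : mdeg (edge_mnm a b) = 2.
Proof. by rewrite mdegD !mdeg1. Qed.

Lemma minorE (i j : 'I_n) : minor K i j = 'X_[edge_mnm i j] - 'X_[edge_mnm j i].
Proof. by rewrite /minor /xvar /yvar !mpolyXD. Qed.

Lemma edge_gensP g : g \in binomial_edge_gens K E ->
  exists i j, E i j /\ g = minor K i j.
Proof.
by move=> /mapP[[i j]]; rewrite mem_enum inE /= => /andP[_ Eij] ->; exists i, j.
Qed.

Lemma edge_gens_homog : {in binomial_edge_gens K E, forall g, g \is 2.-homog}.
Proof.
move=> g /edge_gensP[i [j [_ ->]]]; rewrite minorE.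
by apply: rpredB; rewrite dhomogX /= mdeg_edge_mnm.
Qed.

(** In degree two, an element of the ideal is a linear combination of the
    generators, hence antisymmetric. *)
Lemma edge_quadric (f : S) m : J f -> mdeg m = 2 -> f@_m != 0 ->
  exists a b, [/\ E a b, m = edge_mnm a b & f@_(edge_mnm b a) != 0].
Proof.
move=> /(ideal_gen_coeff edge_gens_homog)[c cP] dm; rewrite cP ?dm // => nz.
have [i nzi] : exists i, c i * (binomial_edge_gens K E)`_i@_m != 0.
  apply: NNPP => no; case/eqP: nz; apply: big1 => i _.
  by apply/eqP/negPn/negP => nzi; apply: no; exists i.
have [a [b [Eab mE]]] : exists a b, E a b /\ m = edge_mnm a b.
  move: nzi; rewrite mulf_eq0 negb_or => /andP[_].
  have /edge_gensP[a [b [Eab ->]]] := mem_nth 0 (ltn_ord i).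
  rewrite minorE mcoeffB !mcoeffX.
  have [<- _|_] := eqVneq (edge_mnm a b) m; first by exists a, b.
  have [<- _|_] := eqVneq (edge_mnm b a) m; first by exists b, a; rewrite E_sym.
  by rewrite subrr eqxx.
exists a, b; split=> //; rewrite cP ?mdeg_edge_mnm //.
apply: contraNneq nz => c0; rewrite -oppr_eq0 -sumrN -[X in _ == X]c0; apply/eqP.
apply: eq_bigr => k _; rewrite -mulrN; congr (_ * _).
have /edge_gensP[i' [j' [_ ->]]] := mem_nth 0 (ltn_ord k).
rewrite mE minorE !mcoeffB !mcoeffX !edge_mnm_eq opprB.
by rewrite [(j' == a) && _]andbC [(i' == a) && _]andbC.
Qed.

Section Sequence.

Variables (f : seq S) (le : rel 'X_{1..(n + n)}).
Hypothesis f_konig : konig_type_wrt J f le.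

Let le_mon : monomial_order le. Proof. by case: f_konig. Qed.

Lemma koenig_quadric p : p \in f -> [/\ J p, p != 0 & p \is 2.-homog].
Proof.
move=> pf; have [_ _ [g gmin] _] := f_konig.
have pfg : p \in f ++ g by rewrite mem_cat pf.
have [nzp hp] :=
  minimal_generator_homog edge_gens_homog (fun _ => conj id id) gmin pfg.
by split=> //; case: gmin => _ gen _; apply/gen/mem_ideal_gen.
Qed.

(** The support of a quadric in [J] contains [x_b y_a] along with [x_a y_b], so
    the initial monomial is the larger one of such a pair. *)
Lemma koenig_arc p : p \in f -> exists a b,
  [/\ in_exp le p = edge_mnm a b, E a b & le (edge_mnm b a) (edge_mnm a b)].
Proof.
case/koenig_quadric=> Jp nzp /dhomogP hp.
have [inp maxp] := in_expP le_mon nzp.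
have [|a [b [Eab mE nz]]] := edge_quadric Jp (hp _ inp).
  by rewrite mcoeff_eq0 negbK.
exists a, b; split=> //; rewrite -mE; apply: maxp.
by rewrite mcoeff_eq0 negbK in nz.
Qed.

Lemma koenig_coprime :
  pairwise (@coprime_mnm (n + n)) [seq in_exp le p | p <- f].
Proof.
have [_ _ _ reg] := f_konig.
apply: (@regular_monomials_coprime K _ _ 2) => [m|].
  move=> /mapP[p /koenig_arc[a [b [-> _ _]]] ->]; exact: mdeg_edge_mnm.
rewrite -map_comp; suff <- : [seq in_mon le p | p <- f] =
    [seq ([eta mpolyX K] \o in_exp le) p | p <- f] by [].
apply/eq_in_map => p pf; rewrite /in_mon.
by have [_ /negPf-> _] := koenig_quadric pf.
Qed.

Lemma attached_block_edge (a b : 'I_n) :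
  attached_block K (edge_mnm a b) = [:: yvar K b - xvar K a].
Proof. by rewrite /attached_block edge_mnm_support. Qed.

Local Notation C := (attached_sequence f le).

Lemma size_attached_sequence : (size C + size f = n + n)%N.
Proof.
have cnt : {in [seq in_exp le p | p <- f],
    forall m : 'X_{1..(n + n)}, count (fun k => m k != 0%N) (enum 'I_(n + n)) = 2}.
  move=> m /mapP[p /koenig_arc[a [b [-> _ _]]] ->].
  rewrite -size_filter (_ : [seq _ <- _ | _] = [:: lshift n a; rshift n b]) //.
  by rewrite -edge_mnm_support; apply: eq_filter => k; rewrite lt0n.
rewrite -[RHS](count_pairwise_coprime cnt koenig_coprime).
rewrite size_cat size_map size_filter size_map muln2 -addnn addnA.
congr (_ + _ + _)%N.
  by apply: eq_count => k; rewrite all_map.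
rewrite size_flatten /shape -map_comp sumnE big_map.
rewrite big_seq (eq_bigr (fun=> 1%N)) => [|p /koenig_arc[a [b [pE _ _]]] /=].
  by rewrite -big_seq sum1_size.
by rewrite pE attached_block_edge.
Qed.

Lemma attached_sequence_special t : t \in C ->
  (exists k, t = 'X_k) \/ (exists k l, k != l /\ t = 'X_k - 'X_l).
Proof.
rewrite mem_cat => /orP[/mapP[k _ ->]|/flattenP[s /mapP[p pf ->]]].
  by left; exists k.
have [a [b [-> _ _]]] := koenig_arc pf.
rewrite attached_block_edge inE => /eqP ->.
by right; exists (rshift n b), (lshift n a); rewrite eq_rlshift.
Qed.

Lemma attached_sequence_linear t : t \in C -> t \is 1.-homog.
Proof.
have hX (k : 'I_(n + n)) : ('X_k : S) \is 1.-homog by rewrite dhomogX /= mdeg1.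
by case/attached_sequence_special => [[k ->]|[k [l [_ ->]]]] //; apply: rpredB.
Qed.

(** Comparison of the formal quotients [x_a / y_a] and [x_b / y_b].  The arcs of
    the initial monomials lead downwards, so they cannot close up to a cycle. *)
Definition above (a b : 'I_n) : bool := (a != b) && le (edge_mnm b a) (edge_mnm a b).

Lemma above_trans a b c : above a b -> above b c -> above a c.
Proof.
have [[_ le_anti le_trans _] [_ leD]] := le_mon.
case/andP=> nab lab /andP[nbc lbc].
have lac : le (edge_mnm c a) (edge_mnm a c).
  (* The product of [x_b y_a <= x_a y_b] and [x_c y_b <= x_b y_c] has the common
     factor [x_b y_b]. *)
  apply: (le_addm_cancel le_mon (m := edge_mnm b b)).
  have e1 : (edge_mnm c a + edge_mnm b b = edge_mnm b a + edge_mnm c b)%MM.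
    by apply/mnmP => k; rewrite !mnmDE; lia.
  have e2 : (edge_mnm a c + edge_mnm b b = edge_mnm a b + edge_mnm b c)%MM.
    by apply/mnmP => k; rewrite !mnmDE; lia.
  rewrite e1 e2; apply: le_trans (leD _ _ _ lab) _.
  by rewrite addmC [X in le _ X]addmC; apply: leD.
rewrite /above lac andbT; apply/eqP => ac; case/negP: nab.
have /edge_mnm_inj[-> //] : edge_mnm a b = edge_mnm b a.
by apply: le_anti; rewrite lab {1}ac ac lbc.
Qed.

Lemma above_irr a : above a a = false.
Proof. by rewrite /above eqxx. Qed.

Section VariablesInPrime.

Variable Q : S -> Prop.
Hypotheses (prQ : prime_ideal Q) (JQ : ideal_sub J Q)
  (CQ : forall t, t \in C -> Q t).

Lemma free_variable_in_prime k :
  (exists2 p, p \in f & in_exp le p k != 0%N) \/ Q 'X_k.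
Proof.
have [/allP free|/allPn] := boolP (all (fun p => in_exp le p k == 0%N) f);
  last by left.
right; apply: CQ; rewrite mem_cat; apply/orP; left; apply/mapP; exists k => //.
by rewrite mem_filter mem_enum andbT; apply/allP.
Qed.

Lemma arc_in_prime p a b : p \in f -> in_exp le p = edge_mnm a b ->
  Q (yvar K b - xvar K a).
Proof.
move=> pf pE; apply: CQ; rewrite mem_cat; apply/orP; right; apply/flattenP.
exists (attached_block K (in_exp le p)); first by apply/mapP; exists p.
by rewrite pE attached_block_edge mem_head.
Qed.

(** Along an arc from [a] to [b] the elements [x_a y_b - x_b y_a] and [y_b - x_a]
    give [x_a ^ 2 = x_b y_a] modulo [Q], so [y_a] in [Q] puts [x_a] and [y_b] in
    [Q]; where no arc arrives at [b], [y_b] is itself part of the sequence. *)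
Lemma yvar_in_prime v : Q (yvar K v).
Proof.
have [idQ _ mulQ] := prQ.
have [r] := ubnP #|[set w | above w v]|; elim: r v => // r IHr b.
rewrite ltnS => le_r.
have [[p pf nz]|//] := free_variable_in_prime (rshift n b).
have [a [b' [pE Eab le_ab]]] := koenig_arc pf.
have bb' : b' = b.
  move: nz; rewrite pE edge_mnmE eq_lrshift (inj_eq (@rshift_inj _ _)).
  by case: (b' =P b).
rewrite bb' in pE Eab le_ab => {b' bb'}.
have ab : above a b.
  by rewrite /above le_ab andbT; apply/eqP => ab; rewrite ab E_irr in Eab.
have Qya : Q (yvar K a).
  apply: IHr; apply: leq_trans le_r; apply: proper_card; apply/properP; split.
    by apply/subsetP => w; rewrite !inE => wa; apply: above_trans ab.
  by exists a; rewrite !inE ?above_irr.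
have Qarc := arc_in_prime pf pE.
have /mulQ[Qxa|//] : Q (xvar K a * yvar K b).
  apply/(ideal_eqmod idQ (f := xvar K a * yvar K b) (g := xvar K b * yvar K a)).
    exact/JQ/(minor_in_edge_ideal K E_sym E_irr Eab).
  exact: ideal_mull.
by apply/(ideal_eqmod idQ Qarc).
Qed.

Lemma xvar_in_prime v : Q (xvar K v).
Proof.
have [idQ _ _] := prQ.
have [[p pf nz]|//] := free_variable_in_prime (lshift n v).
have [a [b [pE Eab _]]] := koenig_arc pf.
have av : a = v.
  move: nz; rewrite pE edge_mnmE eq_rlshift (inj_eq (@lshift_inj _ _)).
  by case: (a =P v).
rewrite av in pE; have Qarc := arc_in_prime pf pE.
by apply/(ideal_eqmod idQ Qarc); apply: yvar_in_prime.
Qed.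

Lemma variable_in_prime k : Q 'X_k.
Proof.
rewrite -[k]splitK; case: (split k) => i /=; first exact: xvar_in_prime.
exact: yvar_in_prime.
Qed.

End VariablesInPrime.

End Sequence.

End KoenigType.

(** * The quotient by the attached sequence *)

Section Origin.

Local Open Scope ring_scope.

Variables (K : fieldType) (N : nat).
Local Notation S := {mpoly K[N]}.

(** The ideal of the variables. *)
Definition origin_ideal (f : S) : Prop := f@_0%MM = 0.

Lemma origin_prime : prime_ideal origin_ideal.
Proof.
rewrite /origin_ideal; split; first split.
- exact: mcoeff0.
- by move=> a f g hf hg; rewrite mcoeffD hg rmorphM /= hf mulr0 addr0.
- by rewrite mcoeff1 eqxx; apply/eqP/oner_neq0.
move=> f g; rewrite rmorphM /= => /eqP.
by rewrite mulf_eq0 => /orP[] /eqP; [left|right].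
Qed.

Lemma origin_sub (I : S -> Prop) : is_ideal I -> (forall k, I 'X_k) ->
  ideal_sub origin_ideal I.
Proof.
move=> idI IX f f0; rewrite [f]mpolyE big_seq; apply: ideal_sum => // m mf.
rewrite -mul_mpolyC; apply: (ideal_mull _ idI).
have [m0|[k nzk]] : m = 0%MM \/ exists k, m k != 0%N.
  have [/eqP ->|nz] := boolP (m == 0%MM); [by left|right].
  apply: NNPP => no; case/eqP: nz; apply/mnmP => k; rewrite mnm0E.
  by apply/eqP/negPn/negP => nzk; apply: no; exists k.
  by move: mf; rewrite m0 -[_ \in _]negbK -mcoeff_eq0 f0 eqxx.
rewrite -lep1mP in nzk; rewrite -(submK nzk) mpolyXD.
exact: ideal_mull.
Qed.

Lemma krull_dim_quot0 (I : S -> Prop) : ideal_sub I origin_ideal ->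
  (forall Q, prime_ideal Q -> ideal_sub I Q -> forall k, Q 'X_k) ->
  krull_dim_quot I 0.
Proof.
move=> I0 varQ; split.
  by exists (fun=> origin_ideal) => //; split=> // i _; apply: origin_prime.
move=> [//|k] C [prC ssC] IC.
have [id0 _ _] := prC 0%N isT; have [id1 C1 _] := prC 1%N isT.
have sub0 := origin_sub id0 (varQ _ (prC 0%N isT) IC).
have [sub01 _] := ssC 0%N isT; have [g Cg nCg] := ideal_ssub_wit (ssC 0%N isT).
exfalso; apply: C1; have nz : g@_0%MM != 0 by apply/eqP => /sub0.
have : C 1%N (g@_0%MM)%:MP.
  rewrite (_ : _%:MP = g - (g - (g@_0%MM)%:MP)); last by ring.
  apply: ideal_subr => //; apply/sub01/sub0.
  by rewrite /origin_ideal mcoeffB mcoeffC eqxx mulr1 subrr.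
move/(ideal_mull ((g@_0%MM)^-1)%:MP id1).
by rewrite -mpolyCM mulVf // mpolyC1.
Qed.

End Origin.

Theorem theorem3p7 (K : fieldType) (n : nat) (E : rel 'I_n)
    (E_sym : ssrbool.symmetric E) (E_irr : irreflexive E)
    (J_konig : konig_type (binomial_edge_ideal K E)) :
  exists (f : seq {mpoly K[n + n]}) (le : rel 'X_{1..(n + n)}),
    konig_type_wrt (binomial_edge_ideal K E) f le /\
    special_system_of_parameters (binomial_edge_ideal K E)
      (attached_sequence f le).
Proof.
have [f [le f_konig]] := J_konig; exists f, le; split=> //.
have [_ htJ _ _] := f_konig.
split; last by move=> t; apply: (attached_sequence_special E_sym f_konig).
have linC := attached_sequence_linear E_sym f_konig.
split.
- by move=> t tC; exists 1 => //; apply: linC.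
- have -> : size (attached_sequence f le) = n + n - size f.
    by have := size_attached_sequence E_sym f_konig; lia.
  exact: edge_ideal_krull_dim.
have idJ := edge_ideal_is_ideal K E.
have idC := ideal_gen_is_ideal (attached_sequence f le).
apply: krull_dim_quot0 => [_ [a [b [Ja Cb ->]]]|Q prQ subQ].
  have homog0 (d : nat) g : 0 < d -> g \is d.-homog -> origin_ideal g.
    by move=> d0 hg; apply: (dhomog_nemf_coeff hg); rewrite /= mdeg0 eq_sym -lt0n.
  have [id0 _ _] := origin_prime K (n + n).
  apply: ideal_addr => //.
    by apply: ideal_gen_sub Ja => // g /edge_gens_homog; apply: homog0.
  by apply: ideal_gen_sub Cb => // g /linC; apply: homog0.
apply: (variable_in_prime E_sym E_irr f_konig prQ) => [g Jg|t tC]; apply: subQ.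
  by exists g, 0%R; split; [|case: idC|rewrite addr0].
exists 0%R, t; split; [by case: idJ|exact: mem_ideal_gen|by rewrite add0r].
Qed.
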